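(* Let $N,M\in\mathbb{N}$ and $x=(x_1,\dots,x_N)^\top\in\mathbb{Z}^N$ with $\|x\|_1\le M$. (1) If $N\ge M$, then for any $S,T\in\mathbb{N}$ there exists $g\in\mathcal{NN}_{1,1}(W,L)$ with \[ W=22\max\Big\{\Big\lceil\frac{\sqrt M}{S\sqrt{T+2}}\Big\rceil,\ \Big\lceil\Big(\frac NM\Big)^{1/T}\Big\rceil\Big\}+10,\qquad L=4S(T+2), \] such that $g(n)=x_n$ for $n=1,\dots,N$. (2) If $N\le M$, then for any $S,T\in\mathbb{N}$ there exists $g\in\mathcal{NN}_{1,1}(W,L)$ with \[ W=22\max\Big\{\Big\lceil\frac{M}{S\sqrt{N(T+2)}}\Big\rceil,\ \Big\lceil\Big(\frac MN\Big)^{1/T}\Big\rceil\Big\}+12,\qquad L=4\Big\lceil\frac{SN}{M}\Big\rceil(T+2), \] such that $g(n)=x_n$ for $n=1,\dots,N$.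
   Context: $\mathcal{NN}_{d,k}(W,L)$: set of maps $g:\mathbb{R}^d\to\mathbb{R}^k$ given by $g_0(x)=x$, $g_{\ell+1}(x)=\sigma(A_\ell g_\ell(x)+b_\ell)$ ($\ell=0,\dots,L-1$), $g(x)=A_Lg_L(x)+b_L$, with $A_\ell\in\mathbb{R}^{N_{\ell+1}\times N_\ell}$, $b_\ell\in\mathbb{R}^{N_{\ell+1}}$, $N_0=d$, $N_{L+1}=k$, $\max\{N_1,\dots,N_L\}\le W$, $\sigma(t)=\max\{t,0\}$ componentwise. *)

(* Defs.v *)
From HB Require Import structures.
From mathcomp Require Import all_boot all_order all_algebra.
From mathcomp Require Import all_classical all_reals exp.
Set Implicit Arguments. Unset Strict Implicit. Unset Printing Implicit Defensive.
Import Order.TTheory GRing.Theory Num.Theory.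
Local Open Scope ring_scope.

Definition relu {R : realType} (t : R) : R := Num.max t 0.

(* Hidden part of a ReLU network: [hidden R m p] maps R^m to R^p through a
   (possibly empty) sequence of layers t |-> relu (A t + b). *)
Inductive hidden (R : realType) : nat -> nat -> Type :=
| HNil : forall n, hidden R n n
| HCons : forall m n p, 'M[R]_(n, m) -> 'cV[R]_n -> hidden R n p -> hidden R m p.

Fixpoint heval (R : realType) m p (h : hidden R m p) : 'cV[R]_m -> 'cV[R]_p :=
  match h in hidden _ m p return 'cV[R]_m -> 'cV[R]_p with
  | HNil _ => fun x => x
  | HCons _ _ _ A b h' => fun x => heval h' (map_mx relu (A *m x + b))
  end.

Fixpoint hdepth (R : realType) m p (h : hidden R m p) : nat :=
  match h with
  | HNil _ => 0%N
  | HCons _ _ _ _ _ h' => (hdepth h').+1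
  end.

Fixpoint hwidth (R : realType) m p (h : hidden R m p) : nat :=
  match h with
  | HNil _ => 0%N
  | HCons _ n _ _ _ h' => maxn n (hwidth h')
  end.

Definition NN (R : realType) (d k W L : nat) (g : 'cV[R]_d -> 'cV[R]_k) : Prop :=
  exists (n : nat) (h : hidden R d n) (A : 'M[R]_(k, n)) (b : 'cV[R]_k),
    hdepth h = L /\ (hwidth h <= W)%N /\
    forall x : 'cV[R]_d, g x = A *m heval h x + b.

(* Main.v *)
Require Import Defs.
From HB Require Import structures.
From mathcomp Require Import all_boot all_order all_algebra.
From mathcomp Require Import all_classical all_reals exp.
From mathcomp Require Import zify ring.
Import Order.TTheory GRing.Theory Num.Theory.
Local Open Scope ring_scope.

Set Implicit Arguments.
Unset Strict Implicit.
Unset Printing Implicit Defensive.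

(** Write each [x j] as a sum of increments, and put a zero increment on a grid
    where needed, so that consecutive increments are at most [w ^ T] apart; the
    number of increments is then at most twice [M] (resp. [N]).  Cut [1..N] into
    blocks such that less than [S] increments lie strictly after the first
    position of each block; there are at most [2 w^2 S (T + 2)] blocks.  The
    network first tabulates, as step functions of its input, the first position
    of the current block, the value there, and an integer whose [(S - 1)(T + 2)]
    digits in base [2 w] list the gaps and sizes of the other increments of the
    block: width [O(w)] yields about [2 w^2] jumps for every two layers.  It then
    pops the digits one layer at a time, subtracts the gaps from the distance to
    the start of the block and adds an increment to the output exactly when this
    distance is [0].  Only integer inputs matter, so every intermediate quantity
    is an integer and all indicators are exact. *)

(** * Networks grown layer by layer and their affine readouts *)

Local Notation ind b := (Posz (nat_of_bool b%R)).

(** [HCons] adds a layer at the input end, but the construction proceeds from input to output. *)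
Fixpoint hsnoc (R : realType) m p (h : hidden R m p) :
    forall q, 'M[R]_(q, p) -> 'cV[R]_q -> hidden R m q :=
  match h in hidden _ m p return forall q, 'M[R]_(q, p) -> 'cV[R]_q -> hidden R m q with
  | HNil _ => fun q A b => HCons A b (HNil R q)
  | HCons _ _ _ A0 b0 h' => fun q A b => HCons A0 b0 (hsnoc h' A b)
  end.

Section Networks.
Variables (R : realType) (X : finType) (inp : X -> 'cV[R]_1).

Lemma heval_hsnoc m p q (h : hidden R m p) (A : 'M[R]_(q, p)) b y :
  heval (hsnoc h A b) y = map_mx relu (A *m heval h y + b).
Proof. by elim: h A y => //= m' n p' A0 b0 h IH A y; rewrite IH. Qed.

Lemma hdepth_hsnoc m p q (h : hidden R m p) (A : 'M[R]_(q, p)) b :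
  hdepth (hsnoc h A b) = (hdepth h).+1.
Proof. by elim: h A => //= m' n p' A0 b0 h IH A; rewrite IH. Qed.

Lemma hwidth_hsnoc m p q (h : hidden R m p) (A : 'M[R]_(q, p)) b :
  hwidth (hsnoc h A b) = maxn (hwidth h) q.
Proof.
elim: h A => /= [n|m' n p' A0 b0 h IH] A; first by rewrite maxn0 max0n.
by rewrite IH maxnA.
Qed.

Record net (W L : nat) := Net {
  net_dim : nat;
  net_hidden : hidden R 1 net_dim;
  net_depth : hdepth net_hidden = L;
  net_width : (hwidth net_hidden <= W)%N }.

(** Only the finitely many inputs [inp x] matter. The next layer absorbs affine maps, so linear
    combinations of readouts cost no neuron. *)
Definition readout W L (a : net W L) (f : X -> int) :=
  exists (A : 'M[R]_(1, net_dim a)) (b : R),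
    forall x, (f x)%:~R = (A *m heval (net_hidden a) (inp x)) ord0 ord0 + b.

Section Closure.
Variables (W L : nat) (a : net W L).

Lemma eq_readout f g : f =1 g -> readout a f -> readout a g.
Proof. by move=> fg [A [b H]]; exists A, b => x; rewrite -fg. Qed.

Lemma readout_cst c : readout a (fun=> c).
Proof. by exists 0, c%:~R => x; rewrite mul0mx mxE add0r. Qed.

Lemma readoutD f g :
  readout a f -> readout a g -> readout a (fun x => f x + g x).
Proof.
move=> [A [b H]] [B [c K]]; exists (A + B), (b + c) => x.
by rewrite rmorphD /= H K mulmxDl [in RHS]mxE addrACA.
Qed.

Lemma readoutZ c f : readout a f -> readout a (fun x => c * f x).
Proof.
move=> [A [b H]]; exists (c%:~R *: A), (c%:~R * b) => x.
by rewrite rmorphM /= H -scalemxAl [in RHS]mxE mulrDr.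
Qed.

Lemma readoutB f g :
  readout a f -> readout a g -> readout a (fun x => f x - g x).
Proof.
move=> Hf Hg; apply: (eq_readout _ (readoutD Hf (readoutZ (-1) Hg))) => x /=.
by rewrite mulN1r.
Qed.

Lemma readout_sum p (f : nat -> X -> int) :
  (forall k, (k < p)%N -> readout a (f k)) ->
  readout a (fun x => \sum_(k < p) f k x).
Proof.
elim: p => [|p IH] H.
  by apply: eq_readout (readout_cst 0) => x; rewrite big_ord0.
apply: (eq_readout (f := fun x => \sum_(k < p) f k x + f p x)).
  by move=> x; rewrite big_ord_recr.
by apply: readoutD; [apply: IH => k kp; apply: H; lia | exact: H].
Qed.

Fixpoint readouts (fs : seq (X -> int)) : Prop :=
  if fs is f :: fs' then readout a f /\ readouts fs' else True.

Lemma readouts_nth (fs : seq (X -> int)) :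
  readouts fs <->
    (forall k, (k < size fs)%N -> readout a (nth (fun=> 0) fs k)).
Proof.
elim: fs => [|f fs IH] //=; split.
  by move=> [Hf /IH H] [|k] //=; exact: H.
by move=> H; split; [exact: (H 0%N) | apply/IH => k; exact: (H k.+1)].
Qed.

End Closure.

(** * ReLU layers, indicators and tabulated step functions *)

Lemma int_fun_bound (f : X -> int) : exists B, forall x, `|f x| <= B.
Proof.
exists (\sum_x `|f x|) => x; rewrite (bigD1 x) //= lerDl.
exact: sumr_ge0.
Qed.

Lemma relu_layer W L (a : net W L) (J : finType) (g : J -> X -> int) :
  (forall j, readout a (g j)) -> (#|J| <= W)%N ->
  exists a' : net W L.+1, forall j, readout a' (fun x => Num.max (g j x) 0).
Proof.
move=> /boolp.choice[A /boolp.choice[b H]] JW.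
pose A1 := \matrix_(i < #|J|, k < net_dim a) A (enum_val i) ord0 k.
pose b1 := \col_(i < #|J|) b (enum_val i).
pose h := hsnoc (net_hidden a) A1 b1.
have hd : hdepth h = L.+1 by rewrite hdepth_hsnoc (net_depth a).
have hw : (hwidth h <= W)%N by rewrite hwidth_hsnoc geq_max JW (net_width a).
exists (Net hd hw) => j; exists (delta_mx ord0 (enum_rank j)), 0 => x.
rewrite -rowE mxE /= /h heval_hsnoc !mxE addr0 /relu.
have -> : b (enum_val (enum_rank j)) = b j by rewrite enum_rankK.
set s := \sum_(k < _) _.
have -> : s + b j = (g j x)%:~R.
  rewrite H mxE; congr (_ + _); apply: eq_bigr => k _.
  by rewrite !mxE enum_rankK.
by case: (lerP (g j x) 0) => gx; [rewrite max_r ?lerz0 | rewrite max_l ?ler0z // ltW].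
Qed.

(** A signal [f k] is carried along by one neuron: [f k + B k] is nonnegative on the finite set of
    inputs, and [B k] is subtracted afterwards. *)
Lemma layer W L (a : net W L) (J K : finType) (g : J -> X -> int)
    (f : K -> X -> int) :
  (forall j, readout a (g j)) -> (forall k, readout a (f k)) ->
  (#|J| + #|K| <= W)%N ->
  exists a' : net W L.+1,
    (forall j, readout a' (fun x => Num.max (g j x) 0)) /\
    (forall k, readout a' (f k)).
Proof.
move=> Hg Hf JKW.
have /boolp.choice[B HB] : forall k, exists b, forall x, `|f k x| <= b.
  by move=> k; exact: int_fun_bound.
pose gf (i : J + K) := match i with inl j => g j | inr k => fun x => f k x + B k end.
have Hgf i : readout a (gf i).
  by case: i => [j|k]; [exact: Hg | apply: readoutD => //; exact: readout_cst].
have [|a' Ha'] := relu_layer Hgf; first by rewrite card_sum.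
exists a'; split=> [j|k]; first exact: (Ha' (inl j)).
apply: (eq_readout _ (readoutB (Ha' (inr k)) (readout_cst a' (B k)))) => x /=.
by have := HB k x; lia.
Qed.

Lemma layer_seq W L (a : net W L) (J : finType) (g : J -> X -> int)
    (fs : seq (X -> int)) :
  (forall j, readout a (g j)) -> readouts a fs -> (#|J| + size fs <= W)%N ->
  exists a' : net W L.+1,
    (forall j, readout a' (fun x => Num.max (g j x) 0)) /\ readouts a' fs.
Proof.
move=> Hg /readouts_nth Hf HW.
have [||a' [H1 H2]] := @layer W L a J 'I_(size fs) g (nth (fun=> 0) fs) Hg.
- by move=> k; exact: Hf.
- by rewrite card_ord.
- exists a'; split=> //; apply/readouts_nth => k kfs.
  exact: (H2 (Ordinal kfs)).
Qed.

Lemma pad_depth W L (a : net W L) f k : (0 < W)%N -> readout a f ->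
  exists a' : net W (L + k), readout a' f.
Proof.
move=> W0; elim: k L a => [|k IH] L a Hf; first by rewrite addn0; exists a.
have [|||a' [_ [Hf' _]]] := @layer_seq W L a void (fun _ _ => 0) [:: f].
- by [].
- by [].
- by rewrite card_void.
- by rewrite addnS -addSn; exact: IH Hf'.
Qed.

(* Each indicator costs two neurons, [s <= u] being
   [max (u - s + 1) 0 - max (u - s) 0] for integers. *)
Lemma step_layer W L (a : net W L) (u : X -> int) p (s : nat -> int)
    (K : finType) (f : K -> X -> int) :
  readout a u -> (forall k, readout a (f k)) -> (2 * p + #|K| <= W)%N ->
  exists a' : net W L.+1,
    (forall j, (j < p)%N -> readout a' (fun x => ind (s j <= u x))) /\
    (forall k, readout a' (f k)).
Proof.
move=> Hu Hf HW.
pose g (j : 'I_p * bool) x := u x + (ind j.2 - s j.1).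
have [|||a' [Hg Hf']] := @layer W L a ('I_p * bool)%type K g f.
- by move=> j; apply: readoutD => //; exact: readout_cst.
- exact: Hf.
- by rewrite card_prod card_ord card_bool mulnC.
exists a'; split=> // j jp.
have := readoutB (Hg (Ordinal jp, true)) (Hg (Ordinal jp, false)).
apply: eq_readout => x; rewrite /g /=; lia.
Qed.

(** Makes any function of a count [m] affine in the indicators of [g < m]. *)
Lemma telescope_lt (phi : nat -> int) m p : (m <= p)%N ->
  phi m = phi 0%N + \sum_(g < p) (phi g.+1 - phi g) * ind (g < m)%N.
Proof.
elim: p => [|p IH] mp.
  by rewrite big_ord0 addr0; move: mp; rewrite leqn0 => /eqP ->.
rewrite big_ord_recr /=; case: (ltnP p m) => pm.
  have -> : m = p.+1 by lia.
  rewrite mulr1 (eq_bigr (fun g : 'I_p => phi g.+1 - phi g)); last first.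
    by move=> g _; rewrite (ltn_trans (ltn_ord g)) ?mulr1.
  by rewrite -(big_mkord xpredT (fun g => phi g.+1 - phi g)) telescope_sumr //; lia.
by rewrite mulr0 addr0 -IH.
Qed.

Lemma down_closed_count (Q : nat -> bool) p :
  (forall g, Q g.+1 -> Q g) ->
  (\sum_(g < p) Q g <= p)%N /\
  forall g, (g < p)%N -> Q g = (g < \sum_(g < p) Q g)%N.
Proof.
move=> Qd; have Qle g k : (g <= k)%N -> Q k -> Q g.
  move=> /subnKC <-; elim: (k - g)%N => [|d IH]; first by rewrite addn0.
  by rewrite addnS => /Qd.
elim: p => [|p [IH1 IH2]]; first by rewrite big_ord0; split.
rewrite big_ord_recr /=; case Qp: (Q p) => /=.
  have E : (\sum_(i < p) Q i = p)%N.
    rewrite -[RHS](card_ord p) -sum1_card; apply: eq_bigr => i _.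
    by rewrite (Qle i p) // ltnW.
  rewrite E addn1; split=> // g gp.
  by rewrite gp (Qle g p).
rewrite addn0; split; first exact: leqW.
move=> g; rewrite ltnS leq_eqVlt => /orP[/eqP ->|]; last exact: IH2.
by rewrite Qp ltnNge IH1.
Qed.

(** With [V] a bound for [|v|], the difference of the positive parts of [v - V * |dl|] and
    [- v - V * |dl|] is [v] if [dl = 0], and [0] for any other integer [dl]. The first layer
    provides [|dl|]. *)
Lemma flush W L (a : net W L) (dl v out C : X -> int) : (7 <= W)%N ->
  readouts a [:: dl; v; out; C] ->
  exists a' : net W (L + 2),
    readouts a' [:: dl; fun x => out x + ind (dl x == 0) * v x; C].
Proof.
move=> W7 [Hdl [Hv [Ho [HC _]]]].
have [V HV] := int_fun_bound v.
have [|||a1 [Hg [Hdl1 [Hv1 [Ho1 [HC1 _]]]]]] :=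
  @layer_seq W L a bool (fun e x => (if e then 1 else -1) * dl x)
    [:: dl; v; out; C].
- by move=> e; exact: readoutZ.
- by [].
- by rewrite card_bool (leq_trans _ W7).
have Habs : readout a1 (fun x => `|dl x|).
  by apply: (eq_readout _ (readoutD (Hg true) (Hg false))) => x /=; lia.
have [|||a2 [Hk [Hdl2 [Ho2 [HC2 _]]]]] :=
  @layer_seq W L.+1 a1 bool (fun e x => (if e then 1 else -1) * v x - V * `|dl x|)
    [:: dl; out; C].
- by move=> e; apply: readoutB; exact: readoutZ.
- by [].
- by rewrite card_bool (leq_trans _ W7).
rewrite addn2; exists a2; split=> //; split=> //.
apply: (eq_readout _ (readoutD Ho2 (readoutB (Hk true) (Hk false)))) => x /=.
have := HV x; case: eqP => [->|dl0] /= vV.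
  rewrite normr0 !mulr0; lia.
have : V <= V * `|dl x|; last lia.
rewrite ler_peMr //; [exact: le_trans vV | lia].
Qed.

(* Two layers evaluate [(p + 1) * q] jumps.  The first one locates the group
   [m] of [q] consecutive thresholds in which [n x] lies, so that thresholds
   and jumps of that group are affine in its neurons; the second one uses that
   [c * (0 <= z) = max (V * (2 * z + 1) + c) 0 - max (V * (2 * z + 1)) 0] for
   integers [z] and [`|c| <= V]. *)
Lemma table_chunk W L (a : net W L) p q (n : X -> int) (t : nat -> int)
    (J : finType) (c : J -> nat -> int) (acc : J -> X -> int) :
  {homo t : k l / (k <= l)%N >-> k <= l} ->
  readout a n -> (forall j, readout a (acc j)) ->
  (2 * p + #|J|.+1 <= W)%N -> (q * #|J| * 2 + #|J|.+1 <= W)%N ->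
  exists a' : net W (L + 2), readout a' n /\
    forall j, readout a' (fun x =>
      acc j x + \sum_(k < p.+1 * q) c j k * ind (t k <= n x)).
Proof.
move=> t_le Hn Hacc HW1 HW2.
pose f1 (o : option J) := if o is Some j then acc j else n.
have [|||a1 [Hs Hf1]] :=
  @step_layer W L a n p (fun g => t (g.+1 * q)%N) (option J) f1.
- by [].
- by case.
- by rewrite card_option.
pose m x := (\sum_(g < p) (t (g.+1 * q)%N <= n x)%R)%N.
have Qm x := @down_closed_count (fun g => t (g.+1 * q)%N <= n x) p
  (fun g => le_trans (t_le _ _ (leq_mul (leqnSn _) (leqnn q)))).
have Hphi (phi : nat -> int) : readout a1 (fun x => phi (m x)).
  apply: (eq_readout (f := fun x => phi 0%N +
    \sum_(g < p) (phi g.+1 - phi g) * ind (t (g.+1 * q)%N <= n x))).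
    move=> x; have [mp Q] := Qm x; rewrite (telescope_lt phi mp).
    by congr (_ + _); apply: eq_bigr => g _; rewrite Q.
  apply: readoutD; first exact: readout_cst.
  apply: (readout_sum (f := fun g x => (phi g.+1 - phi g) * ind (t (g.+1 * q)%N <= n x))).
  by move=> g gp; apply: readoutZ; exact: Hs.
pose V := \sum_j \sum_(k < p.+1 * q) `|c j k|.
have HV j k : (k < p.+1 * q)%N -> `|c j k| <= V.
  move=> kpq; rewrite /V (bigD1 j) //= (bigD1 (Ordinal kpq)) //= -addrA lerDl.
  by rewrite addr_ge0 // sumr_ge0 // => i _; rewrite sumr_ge0.
pose g2 (i : 'I_q * J * bool) x :=
  V * (2 * (n x - t (m x * q + i.1.1)%N) + 1) + ind i.2 * c i.1.2 (m x * q + i.1.1)%N.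
(* The groups before that of [n x] contribute a total depending on [m x] only, so it joins [acc j]
   without extra neurons. *)
pose f2 (o : option J) := if o is Some j then
  fun x => acc j x + \sum_(k < m x * q) c j k else n.
have [|||a2 [Hg2 Hf2]] := @layer W L.+1 a1 ('I_q * J * bool)%type (option J) g2 f2.
- move=> [[r j] e]; apply: readoutD; last first.
    by apply: readoutZ; exact: (Hphi (fun m => c j (m * q + r)%N)).
  apply: readoutZ; apply: readoutD; last exact: readout_cst.
  apply: readoutZ; apply: readoutB; first exact: (Hf1 None).
  exact: (Hphi (fun m => t (m * q + r)%N)).
- case=> [j|]; last exact: (Hf1 None).
  apply: readoutD; first exact: (Hf1 (Some j)).
  exact: (Hphi (fun m => \sum_(k < m * q) c j k)).
- by rewrite !card_prod card_ord card_bool card_option.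
rewrite addn2; exists a2; split=> [|j]; first exact: (Hf2 None).
have H r : (r < q)%N ->
    readout a2 (fun x => c j (m x * q + r)%N * ind (t (m x * q + r)%N <= n x)).
  move=> rq; have := readoutB (Hg2 (Ordinal rq, j, true)) (Hg2 (Ordinal rq, j, false)).
  apply: eq_readout => x; rewrite /g2 /= mul1r mul0r addr0.
  have [mp _] := Qm x.
  have := HV j (m x * q + r)%N.
  have -> : (m x * q + r < p.+1 * q)%N.
    rewrite (@leq_trans ((m x).+1 * q)) //; last by rewrite leq_mul2r ltnS mp orbT.
    by rewrite mulSn addnC ltn_add2r.
  move=> /(_ isT); move: (c j _) (t _) => cc tt cV.
  have V0 : 0 <= V by exact: le_trans cV.
  case: (lerP tt (n x)) => tn /=.
    have : V <= V * (2 * (n x - tt) + 1) by rewrite ler_peMr //; lia.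
    lia.
  have : V * (2 * (n x - tt) + 1) <= - V by rewrite -[- V]mulrN1 ler_wpM2l //; lia.
  lia.
have := readoutD (Hf2 (Some j)) (readout_sum H).
apply: eq_readout => x; rewrite /f2 -addrA; congr (_ + _).
have [mp Q] := Qm x; rewrite -(big_mkord xpredT (c j)).
rewrite -(big_mkord xpredT (fun k => c j k * ind (t k <= n x))).
rewrite -(big_mkord xpredT (fun r => c j (m x * q + r)%N * ind (t (m x * q + r)%N <= n x))).
have mq : (m x * q + q <= p.+1 * q)%N by rewrite addnC -mulSn leq_mul2r ltnS mp orbT.
(* All indicators are [1] before group [m x] and [0] after it. *)
rewrite (big_cat_nat (leq0n _) (leq_trans (leq_addr q (m x * q)) mq)) /=.
congr (_ + _).
  rewrite !big_nat; apply: eq_bigr => k /andP[_ kmq].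
  have -> : t k <= n x; last by rewrite mulr1.
  have m0 : (0 < m x)%N by case: (m x) kmq.
  have := Q (m x).-1; rewrite prednK // => /(_ mp) tm.
  have {}tm : t (m x * q)%N <= n x by rewrite tm; exact: leqnn.
  by apply: le_trans tm; exact: t_le (ltnW kmq).
rewrite (big_cat_nat (leq_addr q (m x * q)) mq) /=.
rewrite [X in _ = _ + X]big_nat [X in _ = _ + X]big1 ?addr0.
  rewrite (addnC (m x * q)%N q) -[X in _ = \sum_(X <= k < _) _]add0n big_addn addnK.
  by apply: eq_bigr => r _; rewrite addnC.
move=> k /andP[mqk kpq].
have -> : t k <= n x = false; last by rewrite mulr0.
have mltp : (m x < p)%N.
  rewrite ltn_neqAle mp andbT; apply/negP => /eqP E.
  by move: mqk kpq; rewrite E mulSn; lia.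
have {}Q : t ((m x).+1 * q)%N <= n x = false.
  by rewrite (Q (m x) mltp); exact: ltnn.
apply: contraFF Q => tk; apply: le_trans tk; apply: t_le.
by rewrite mulSn addnC.
Qed.

Lemma table W L (a : net W L) d p q (n : X -> int) (t : nat -> int)
    (J : finType) (c : J -> nat -> int) (acc : J -> X -> int) :
  {homo t : k l / (k <= l)%N >-> k <= l} ->
  readout a n -> (forall j, readout a (acc j)) ->
  (2 * p + #|J|.+1 <= W)%N -> (q * #|J| * 2 + #|J|.+1 <= W)%N ->
  exists a' : net W (L + d * 2), readout a' n /\
    forall j, readout a' (fun x =>
      acc j x + \sum_(k < d * (p.+1 * q)) c j k * ind (t k <= n x)).
Proof.
elim: d L a t c acc => [|d IH] L a t c acc t_le Hn Hacc W1 W2.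
  rewrite mul0n addn0; exists a; split=> // j.
  by apply: eq_readout (Hacc j) => x; rewrite mul0n big_ord0 addr0.
have [a1 [Hn1 Ha1]] := @table_chunk W L a p q n t J c acc t_le Hn Hacc W1 W2.
set e := (p.+1 * q)%N in Ha1 *.
have t_le' : {homo (fun k => t (e + k)%N) : k l / (k <= l)%N >-> k <= l}.
  by move=> k l kl; apply: t_le; rewrite leq_add2l.
have [a2 [Hn2 Ha2]] := IH _ a1 _ (fun j k => c j (e + k)%N) _ t_le' Hn1 Ha1 W1 W2.
rewrite mulSn addnA; exists a2; split=> // j.
apply: eq_readout (Ha2 j) => x; rewrite -addrA; congr (_ + _).
by rewrite (mulSn d) [RHS]big_split_ord.
Qed.

Lemma step_layer_seq W L (a : net W L) (u : X -> int) p (s : nat -> int)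
    (fs : seq (X -> int)) :
  readout a u -> readouts a fs -> (2 * p + size fs <= W)%N ->
  exists a' : net W L.+1,
    (forall j, (j < p)%N -> readout a' (fun x => ind (s j <= u x))) /\
    readouts a' fs.
Proof.
move=> Hu /readouts_nth Hf HW.
have [|||a' [H1 H2]] :=
  @step_layer W L a u p s 'I_(size fs) (nth (fun=> 0) fs).
- by [].
- by move=> k; exact: Hf.
- by rewrite card_ord.
exists a'; split=> //; apply/readouts_nth => k kfs.
exact: (H2 (Ordinal kfs)).
Qed.

(** * Extraction of radix digits and the decoding loop *)

Definition digit_code (base : nat) (d : nat -> nat) (e : nat) : nat :=
  (\sum_(k < e) d k * base ^ k)%N.

Lemma digit_codeS base d e : digit_code base d e.+1 = (digit_code base d e + d e * base ^ e)%N.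
Proof. by rewrite /digit_code big_ord_recr. Qed.

Lemma digit_code_lt base d e : (forall k, (d k < base)%N) -> (digit_code base d e < base ^ e)%N.
Proof.
move=> db; elim: e => [|e IH]; first by rewrite /digit_code big_ord0.
rewrite digit_codeS expnS (@leq_trans ((d e).+1 * base ^ e)) //.
  by rewrite mulSn ltn_add2r.
by rewrite leq_mul2r db orbT.
Qed.

(** The lower digits total less than [base ^ e], so the top digit is the number of [j < base] with
    [(j + 1) * base ^ e] at most the code. Each indicator takes two neurons, each of the four
    carried signals one. *)
Lemma pop_digit W L (a : net W L) base (d : X -> nat -> nat) e al ga
    (dl v out : X -> int) :
  (forall x k, (d x k < base)%N) -> (2 * base + 4 <= W)%N ->
  readouts a [:: dl; v; out; fun x => (digit_code base (d x) e.+1)%:Z] ->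
  exists a' : net W L.+1,
    readouts a' [:: fun x => dl x - al * (d x e)%:Z;
                    fun x => v x + ga * (d x e)%:Z; out;
                    fun x => (digit_code base (d x) e)%:Z].
Proof.
move=> db HW Hfs; have HC := Hfs.2.2.2.1.
have [a' [Hs [Hdl [Hv [Ho [HC' _]]]]]] :=
  step_layer_seq (p := base) (fun j => (j.+1 * base ^ e)%N%:Z) HC Hfs HW.
have Hd : readout a' (fun x => (d x e)%:Z).
  apply: eq_readout (readout_sum Hs) => x /=.
  have b0 : (0 < base ^ e)%N by rewrite expn_gt0 (leq_trans _ (db x 0%N)).
  rewrite (telescope_lt (fun k => k%:Z) (ltnW (db x e))) add0r.
  apply: eq_bigr => j _; rewrite -addn1 PoszD addrAC subrr add0r mul1r.
  congr (ind _); rewrite lez_nat digit_codeS addn1; apply/idP/idP => [H|].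
    rewrite -(ltn_pmul2r b0) -(ltn_add2l (base ^ e)) -mulSn.
    by rewrite (leq_ltn_trans H) // ltn_add2r digit_code_lt.
  by rewrite -(leq_pmul2r b0) => /leq_trans -> //; exact: leq_addl.
exists a'; split; first by apply: readoutB => //; exact: readoutZ.
split; first by apply: readoutD => //; exact: readoutZ.
split=> //; split=> //.
apply: (eq_readout _ (readoutB HC' (readoutZ (base ^ e)%N%:Z Hd))) => x /=.
by rewrite digit_codeS PoszD PoszM [X in _ - X]mulrC addrK.
Qed.

(** Gap and size of one increment are linear forms in its [m] digits, with weights [al] and [ga], so
    [dl] and [v] are updated while the digits are popped. *)
Lemma pop_digits W L (a : net W L) base (d : X -> nat -> nat) e m
    (al ga : nat -> int) (dl v out : X -> int) :
  (forall x k, (d x k < base)%N) -> (2 * base + 4 <= W)%N ->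
  readouts a [:: dl; v; out; fun x => (digit_code base (d x) (e + m))%:Z] ->
  exists a' : net W (L + m),
    readouts a' [:: fun x => dl x - \sum_(t < m) al t * (d x (e + t)%N)%:Z;
                    fun x => v x + \sum_(t < m) ga t * (d x (e + t)%N)%:Z; out;
                    fun x => (digit_code base (d x) e)%:Z].
Proof.
move=> db HW; elim: m L a dl v => [|m IH] L a dl v.
  rewrite !addn0 => -[Hdl [Hv [Ho [HC _]]]]; exists a.
  split; first by apply: eq_readout Hdl => x; rewrite big_ord0 subr0.
  by split; first by apply: eq_readout Hv => x; rewrite big_ord0 addr0.
rewrite !addnS -addSn => Hfs.
have [a1 Ha1] := @pop_digit W L a base d (e + m) (al m) (ga m) dl v out db HW Hfs.
have [a2 [Hdl [Hv [Ho [HC _]]]]] := IH _ _ _ _ Ha1.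
exists a2; split.
  by apply: eq_readout Hdl => x; rewrite big_ord_recr /= opprD addrA addrAC.
split=> //.
by apply: eq_readout Hv => x; rewrite big_ord_recr /= addrA addrAC.
Qed.

(* [dl] is the distance still to travel and [v] the increment located at the
   current position; items are read from index [s - 1] down to [0], as digits
   are popped from the most significant one. *)
Fixpoint decode_loop (s : nat) (gap val : nat -> int) (dl v : int) : int :=
  ind (dl == 0) * v +
  if s is s'.+1 then decode_loop s' gap val (dl - gap s') (val s') else 0.

Lemma decode_net W L (a : net W L) base (d : X -> nat -> nat) m s
    (al ga : nat -> int) (dl v out : X -> int) :
  (forall x k, (d x k < base)%N) -> (2 * base + 4 <= W)%N -> (7 <= W)%N ->
  readouts a [:: dl; v; out; fun x => (digit_code base (d x) (s * m))%:Z] ->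
  exists a' : net W (L + (s * (m + 2) + 2)), readout a' (fun x => out x +
    decode_loop s (fun l => \sum_(t < m) al t * (d x (l * m + t)%N)%:Z)
             (fun l => \sum_(t < m) ga t * (d x (l * m + t)%N)%:Z) (dl x) (v x)).
Proof.
move=> db HW W7; elim: s L a dl v out => [|s IH] L a dl v out Hfs.
  have [a1 [_ [Ho _]]] := flush W7 Hfs.
  by exists a1; apply: eq_readout Ho => x /=; rewrite addr0.
have [a1 [Hdl [Ho [HC _]]]] := flush W7 Hfs.
(* [v] restarts from [0]: the next [m] digits add up the new increment in it. *)
have Hfs1 : readouts a1 [:: dl; fun=> 0; fun x => out x + ind (dl x == 0) * v x;
    fun x => (digit_code base (d x) (s * m + m))%:Z].
  split=> //; split; first exact: readout_cst.
  split=> //; split=> //.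
  by apply: eq_readout HC => x; rewrite mulSn addnC.
have [a2 Ha2] := pop_digits al ga db HW Hfs1.
have [a3 Ha3] := IH _ _ _ _ _ Ha2.
have -> : (L + (s.+1 * (m + 2) + 2) = L + 2 + m + (s * (m + 2) + 2))%N by lia.
exists a3; apply: eq_readout Ha3 => x /=.
by rewrite add0r addrA.
Qed.

End Networks.

(** * Decoding as a run through a list of increments *)

Fixpoint run (its : seq (nat * int)) (dl v : int) : int :=
  ind (dl == 0) * v +
  if its is it :: its' then run its' (dl - it.1%:Z) it.2 else 0.

(** [decode_loop] counts down while the list is read from its head, hence the index [s - l.+1].
    Missing items default to [(0, 0)] and add nothing. *)
Lemma decode_run s its gap val dl v : (size its <= s)%N ->
  (forall l, (l < s)%N -> gap l = (nth (0%N, 0) its (s - l.+1)).1%:Z) ->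
  (forall l, (l < s)%N -> val l = (nth (0%N, 0) its (s - l.+1)).2) ->
  decode_loop s gap val dl v = run its dl v.
Proof.
elim: s its dl v => [|s IH] [|it its] dl v //= Hs Hg Hv.
  rewrite (IH [::]) // ?Hv //.
  - by rewrite nth_nil /= mulr0 !addr0.
  - by move=> l ls; rewrite Hg ?nth_nil // ltnW.
  - by move=> l ls; rewrite Hv ?nth_nil // ltnW.
rewrite Hg // Hv // subnn /= (IH its) // => l ls;
  have E : (s.+1 - l.+1 = (s - l.+1).+1)%N by lia.
  by rewrite Hg ?E // ltnS ltnW.
by rewrite Hv ?E // ltnS ltnW.
Qed.

Lemma run0 its dl v : run its dl v = ind (dl == 0) * v + run its dl 0.
Proof. by case: its => [|it its] /=; rewrite mulr0 add0r ?addr0. Qed.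

Lemma run_zero_gaps us its dl u :
  run ([seq (0%N, u') | u' <- us] ++ its) dl u =
  ind (dl == 0) * (u + \sum_(u' <- us) u') + run its dl 0.
Proof.
elim: us u => [|u' us IH] u; first by rewrite big_nil addr0 run0.
by rewrite /= subr0 IH big_cons addrA -mulrDr.
Qed.

Section Items.
Variable vs : nat -> seq int.

Definition vs_sum j : int := \sum_(u <- vs j) u.

(* The increments [vs j] of the positions [j] with [p + g <= j < p + g + m],
   each preceded by the distance to the position of the previous increment;
   that position is [p] at the beginning. *)
Fixpoint items (m p g : nat) : seq (nat * int) :=
  if m is m'.+1 then
    if vs (p + g)%N is u :: us then
      (g, u) :: [seq (0%N, u') | u' <- us] ++ items m' (p + g) 1
    else items m' p g.+1
  else [::].

(** The gaps up to position [p + g + k] sum to its distance [g + k] from [p], so the remaining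
    distance vanishes there exactly when [dl = g + k]. *)
Lemma run_items m p g dl v : run (items m p g) dl v =
  ind (dl == 0) * v +
  \sum_(k < m) ind (dl == (g + k)%N%:Z) * vs_sum (p + g + k).
Proof.
elim: m p g dl v => [|m IH] p g dl v /=; first by rewrite big_ord0.
rewrite big_ord_recl !addn0 /vs_sum; case E : (vs (p + g)%N) => [|u us] /=.
  rewrite IH big_nil mulr0 add0r; congr (_ + _); apply: eq_bigr => k _.
  by rewrite /bump /= add1n !addnS !addSn.
rewrite run_zero_gaps IH mulr0 add0r big_cons subr_eq0; congr (_ + (_ + _)).
apply: eq_bigr => k _; rewrite /bump /= subr_eq -PoszD.
by rewrite -[in LHS](addnA (p + g)%N) (addnC (1 + k)%N g).
Qed.

Lemma size_items m p g :
  size (items m p g) = (\sum_(k < m) size (vs (p + g + k)%N))%N.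
Proof.
elim: m p g => [|m IH] p g /=; first by rewrite big_ord0.
rewrite big_ord_recl addn0; case E : (vs (p + g)%N) => [|u us] /=.
  by rewrite IH add0n; apply: eq_bigr => k _; rewrite /bump /= add1n !addnS !addSn.
rewrite size_cat size_map IH addSn; congr (_ + _).+1.
by apply: eq_bigr => k _; rewrite /bump /= addnA.
Qed.

(** A gap above [G] would leave the [G] positions after [p] empty, against the first hypothesis. The
    second one is the invariant of the recursion. *)
Lemma mem_items G m p g :
  (forall j, exists2 l, (l < G)%N & vs (j + l)%N != [::]) ->
  (forall l, (0 < l < g)%N -> vs (p + l)%N = [::]) ->
  forall it, it \in items m p g ->
  (it.1 <= G)%N /\ exists j, it.2 \in vs j.
Proof.
move=> HG; elim: m p g => [|m IH] p g Hpg it //=.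
case E : (vs (p + g)%N) => [|u us].
  apply: IH => l /andP[l0]; rewrite ltnS leq_eqVlt => /orP[/eqP -> //|lg].
  by apply: Hpg; rewrite l0.
rewrite inE mem_cat => /or3P[/eqP ->|/mapP[u' u'us ->]|] /=.
- split; last by exists (p + g)%N; rewrite E mem_head.
  rewrite leqNgt; apply/negP => Gg; have [l lG] := HG p.+1.
  by rewrite addSnnS Hpg //=; lia.
- by split=> //; exists (p + g)%N; rewrite E inE u'us orbT.
- by apply: IH => l; lia.
Qed.

End Items.

(** * The network for given lists of increments *)

Section Construction.
Variables (R : realType) (N : nat) (vs : nat -> seq int) (S m w W G : nat).
Variables al ga : nat -> int.
Hypotheses (S_gt0 : (0 < S)%N) (m_gt1 : (1 < m)%N) (w_gt0 : (0 < w)%N).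
Hypothesis W_ge : (22 * w + 10 <= W)%N.
Hypothesis gaps : forall j, exists2 l, (l < G)%N & vs (j + l)%N != [::].
Hypothesis encode : forall g u j, (g <= G)%N -> u \in vs j ->
  exists d : nat -> nat, [/\ forall t, (d t < 2 * w)%N,
    \sum_(t < m) al t * (d t)%:Z = g%:Z & \sum_(t < m) ga t * (d t)%:Z = u].
Hypothesis weight :
  (\sum_(j < N) size (vs j) <= 2 * w ^ 2 * S ^ 2 * m)%N.

(** [b n] is the block number of position [n]. As [b] is monotone, [t k] is the first position with
    block number at least [k], or [N] if there is none. [its k] omits the increments at [t k]
    itself. *)
Let P n := (\sum_(j < n.+1) size (vs j))%N.
Let b n := (P n %/ S)%N.
Let t k := (\sum_(j < N) (b j < k))%N.
Let its k := items vs (t k.+1 - (t k).+1) (t k) 1.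

Let P_le i j : (i <= j)%N -> (P i <= P j)%N.
Proof.
move=> ij; rewrite /P -(subnKC ij) -addSn big_split_ord /=; exact: leq_addr.
Qed.

Let b_le i j : (i <= j)%N -> (b i <= b j)%N.
Proof. by move=> ij; rewrite leq_div2r // P_le. Qed.

Let t_leE k i : (i < N)%N -> (t k <= i)%N = (k <= b i)%N.
Proof.
move=> iN; have [|_ H] := @down_closed_count (fun j => (b j < k)%N) N.
  by move=> g; apply: leq_ltn_trans; exact: b_le.
by rewrite leqNgt -(H i iN) -leqNgt.
Qed.

Let t_le k l : (k <= l)%N -> (t k <= t l)%N.
Proof.
move=> kl; apply: leq_sum => j _; have [bk|//] := ltnP (b j) k.
by rewrite (leq_trans bk kl).
Qed.

Let b_lt i : (i < N)%N -> (b i <= S * m * ((2 * w).+1 * w))%N.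
Proof.
move=> iN; rewrite /b -(leq_pmul2r S_gt0) (leq_trans (leq_trunc_div _ _)) //.
have PN : (P i <= \sum_(j < N) size (vs j))%N.
  by rewrite /P -(subnKC iN) big_split_ord /=; exact: leq_addr.
apply: (leq_trans PN (leq_trans weight _)); nia.
Qed.

(** With [k = b i], at least [k * S] increments lie at positions up to [t k], and fewer than
    [(k + 1) * S] up to the end of block [k]. *)
Let size_its i : (i < N)%N -> (size (its (b i)) <= S.-1)%N.
Proof.
move=> iN; set k := b i.
have tki : (t k <= i)%N by rewrite t_leE.
have itk : (i < t k.+1)%N by rewrite ltnNge t_leE // ltnn.
have tN : (t k.+1 <= N)%N.
  rewrite /t -[X in (_ <= X)%N]card_ord -sum1_card; apply: leq_sum => j _.
  exact: leq_b1.
rewrite /its size_items.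
set r := (t k.+1 - (t k).+1)%N; set s := (\sum_(_ < _) _)%N.
have E : P (t k + r) = (P (t k) + s)%N.
  rewrite /P -addSn big_split_ord /=; congr addn; apply: eq_bigr => l _.
  by rewrite addn1.
have bt : (k <= b (t k))%N by rewrite -t_leE // (leq_ltn_trans tki).
have bl : (b (t k + r) < k.+1)%N.
  by rewrite ltnNge -t_leE; rewrite /r; lia.
move: bt bl; rewrite /b leq_divRL // ltn_divLR // E mulSn; lia.
Qed.

Let run_its i : (i < N)%N ->
  run (its (b i)) (i%:Z - (t (b i))%:Z) (vs_sum vs (t (b i))) = vs_sum vs i.
Proof.
move=> iN; set k := b i.
have tki : (t k <= i)%N by rewrite t_leE.
have itk : (i < t k.+1)%N by rewrite ltnNge t_leE // ltnn.
rewrite /its run_items.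
move: tki; rewrite leq_eqVlt => /orP[/eqP E|tki].
  rewrite E subrr eqxx mul1r big1 ?addr0 // => j _.
  by rewrite add1n mul0r.
have jP : (i - (t k).+1 < t k.+1 - (t k).+1)%N by lia.
rewrite (bigD1 (Ordinal jP)) //= big1 ?addr0.
  have -> : (i%:Z - (t k)%:Z == 0) = false by lia.
  have -> : (i%:Z - (t k)%:Z == (1 + (i - (t k).+1))%N%:Z) by lia.
  rewrite mul0r add0r mul1r; congr (vs_sum vs _); lia.
move=> j; rewrite -val_eqE /= => jne.
have -> : (i%:Z - (t k)%:Z == (1 + j)%N%:Z) = false by lia.
by rewrite mul0r.
Qed.

Let inp (i : 'I_N) : 'cV[R]_1 := const_mx (i.+1)%:R.

Lemma block_network : exists g : 'cV[R]_1 -> 'cV[R]_1,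
  NN W (4 * S * m) g /\
  forall i : 'I_N, g (const_mx (i.+1)%:R) ord0 ord0 = (vs_sum vs i)%:~R.
Proof.
(* Digits of the list entries, in reverse order because the most significant digits are popped
   first; entries beyond the list get zero digits. *)
have /boolp.choice[D /all_and3[D_lt Dal Dga]] : forall kl : nat * nat,
    exists d : nat -> nat, let it := nth (0%N, 0) (its kl.1) (S.-1 - kl.2.+1) in
    [/\ forall t, (d t < 2 * w)%N, \sum_(t < m) al t * (d t)%:Z = it.1%:Z
      & \sum_(t < m) ga t * (d t)%:Z = it.2].
  move=> [k l] /=; set e := (_ - _)%N.
  have [elt|ege] := ltnP e (size (its k)); last first.
    rewrite nth_default //; exists (fun=> 0%N); split=> [t'||].
    - by rewrite muln_gt0.
    - by rewrite big1 // => *; rewrite mulr0.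
    - by rewrite big1 // => *; rewrite mulr0.
  have [|g [j uj]] := mem_items gaps _ (mem_nth (0%N, 0) elt); first by lia.
  exact: encode g uj.
pose dig k e := D (k, (e %/ m)%N) (e %% m)%N.
have digE k l r : (r < m)%N -> dig k (l * m + r)%N = D (k, l) r.
  move=> rm; rewrite /dig divnMDl ?(ltn_trans _ m_gt1) //.
  by rewrite divn_small // addn0 modnMDl modn_small.
pose F (o : option bool) k : int := match o with
  | None => (t k)%:Z
  | Some true => vs_sum vs (t k)
  | Some false => (digit_code (2 * w) (dig k) (S.-1 * m))%:Z
  end.
pose a0 := @Net R W 0 1 (HNil R 1) erefl (leq0n W).
(* The input of index [i] is [i + 1], hence the shift by [-1]. *)
have n0 : readout inp a0 (fun i => (i : nat)%:Z).
  exists 1%:M, (-1) => i; rewrite mul1mx mxE /= -pmulrn -natr1; ring.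
have t'_le : {homo (fun k => (t k.+1)%:Z) : k l / (k <= l)%N >-> k <= l}.
  by move=> k l kl; rewrite lez_nat t_le.
(* Widths [4 * w + 4] and [6 * w + 4] suffice, and [S * m] chunks give enough jumps to reach every
   [b i], by [b_lt]. *)
have [|||a1 [n1 F1]] := @table R _ inp W 0 a0 (S * m) (2 * w) w _ _
  (option bool) (fun o k => F o k.+1 - F o k) (fun o _ => F o 0%N) t'_le n0.
- by move=> o; exact: readout_cst.
- by rewrite card_option card_bool; lia.
- by rewrite card_option card_bool; lia.
have {}F1 o : readout inp a1 (fun i => F o (b i)).
  apply: eq_readout (F1 o) => i.
  rewrite (telescope_lt (F o) (b_lt (ltn_ord i))); congr (_ + _).
  by apply: eq_bigr => k _; rewrite lez_nat t_leE.
have [||||a2 Ha2] := @decode_net R _ inp W _ a1 (2 * w) (fun i : 'I_N => dig (b i))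
  m S.-1 al ga (fun i => (i : nat)%:Z - (t (b i))%:Z)
  (fun i => vs_sum vs (t (b i))) (fun=> 0).
- by move=> i k; exact: D_lt.
- by lia.
- by lia.
- split; first by apply: readoutB n1 (F1 None).
  split; first exact: F1 (Some true).
  split; first exact: readout_cst.
  by split=> //; exact: F1 (Some false).
have W0 : (0 < W)%N by lia.
(* The depth so far is [3 * S * m + 2 * S - m], at most [4 * S * m] because [m >= 2]. *)
have [a3 [A [c H]]] := pad_depth (4 * S * m - (0 + S * m * 2 + (S.-1 * (m + 2) + 2)))
  W0 Ha2.
exists (fun x => A *m heval (net_hidden a3) x + const_mx c); split.
  exists (net_dim a3), (net_hidden a3), A, (const_mx c); split; last first.
    by split=> //; exact: net_width.
  rewrite net_depth subnKC //; nia.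
move=> i; rewrite mxE [X in _ + X]mxE -H add0r; congr (_%:~R).
rewrite -(run_its (ltn_ord i)); apply: decode_run.
- exact: size_its.
- move=> l lS; rewrite -(Dal (b i, l)) /=.
  by apply: eq_bigr => r _; rewrite digE.
- move=> l lS; rewrite -(Dga (b i, l)) /=.
  by apply: eq_bigr => r _; rewrite digE.
Qed.

End Construction.

(** * Encoding of increments by digits: sparse and dense case *)

(** The [T] low digits spell [u]; the two free digits will hold a sign, a unit or a short gap. *)
Lemma radix_digits base T u p q : (u < base ^ T)%N -> (p < base)%N ->
  (q < base)%N -> exists d : nat -> nat,
  [/\ forall t, (d t < base)%N, \sum_(t < T) (base ^ t)%N%:Z * (d t)%:Z = u%:Z,
      d T = p & d T.+1 = q].
Proof.
move=> uT pb qb; elim: T u uT => [|T IH] u uT.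
  exists (fun t => if t is 0%N then p else q); split=> //; first by case.
  by rewrite big_ord0; case: u uT.
have b0 : (0 < base)%N by exact: leq_ltn_trans pb.
have [|d [d_lt dE dT dT1]] := IH (u %/ base)%N; first by rewrite ltn_divLR // -expnSr.
exists (fun t => if t is t'.+1 then d t' else (u %% base)%N); split=> //.
  by case=> [|t]; [exact: ltn_pmod | exact: d_lt].
rewrite big_ord_recl mul1r [in RHS](divn_eq u base) PoszD PoszM -dE addrC mulr_suml.
by congr (_ + _); apply: eq_bigr => t _; rewrite expnS PoszM; ring.
Qed.

Lemma sum_nseq n (c : int) : \sum_(u <- nseq n c) u = c * n%:Z.
Proof.
by elim: n => [|n IH]; rewrite ?big_nil ?mulr0 //= big_cons IH intS mulrDr mulr1.
Qed.

Lemma count_dvdn G n : (0 < G)%N -> (\sum_(j < n) (G %| j.+1) = n %/ G)%N.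
Proof.
move=> G0; elim: n => [|n IH]; first by rewrite big_ord0 div0n.
by rewrite big_ord_recr /= IH divnS // addnC.
Qed.

Section Cases.
Variables (R : realType) (N M : nat) (xs : nat -> int) (S T w W : nat).
Hypotheses (S_gt0 : (0 < S)%N) (T_gt0 : (0 < T)%N) (w_gt0 : (0 < w)%N).
Hypothesis W_ge : (22 * w + 10 <= W)%N.
Hypothesis xsM : (\sum_(j < N) `|xs j| <= M)%N.

Let G := (w ^ T)%N.
Let B := (2 * w)%N.

Let G_gt0 : (0 < G)%N. Proof. by rewrite expn_gt0 w_gt0. Qed.

Let G_lt : (G < B ^ T)%N.
Proof. by rewrite /B expnMn ltn_Pmull // -{1}(exp1n T) ltn_exp2r. Qed.

(* The increments at [j] are [`|xs j|] units, and an extra zero increment on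
   the grid [G %| j.+1] keeps consecutive increments at distance at most [G]. *)
Lemma sparse_network :
  (M <= w ^ 2 * S ^ 2 * T.+2)%N -> (N <= G * M)%N ->
  exists g : 'cV[R]_1 -> 'cV[R]_1, NN W (4 * S * T.+2) g /\
    forall i : 'I_N, g (const_mx (i.+1)%:R) ord0 ord0 = (xs i)%:~R.
Proof.
move=> HM HN.
pose vs j := nseq (G %| j.+1) 0 ++ nseq `|xs j| (sgz (xs j)).
(* The [T] low digits hold the gap; digit [T] minus digit [T.+1] is the increment [1], [-1] or
   [0]. *)
pose al t : int := if (t < T)%N then (B ^ t)%N%:Z else 0.
pose ga t : int := if t == T then 1 else if t == T.+1 then -1 else 0.
have [||||g [Hg gE]] := @block_network R N vs S T.+2 w W G al ga S_gt0 _ w_gt0 W_ge.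
- by [].
- move=> j; exists (G.-1 - j %% G)%N; first by lia.
  rewrite /vs; have -> : (G %| (j + (G.-1 - j %% G)).+1)%N; last by [].
  have -> : ((j + (G.-1 - j %% G)).+1 = (j %/ G).+1 * G)%N.
    by have := ltn_pmod j G_gt0; rewrite {1}(divn_eq j G) mulSn; lia.
  exact: dvdn_mull.
- move=> g u j gG; rewrite mem_cat !mem_nseq => Hu.
  have {}Hu : u = ind (u == 1) - ind (u == -1).
    by case/orP: Hu => /andP[_ /eqP ->] //; case: sgzP.
  have lt1 (c : bool) : (c < B)%N by rewrite /B; case: c; lia.
  have [d [d_lt dE dT dT1]] :=
    radix_digits (leq_ltn_trans gG G_lt) (lt1 (u == 1)) (lt1 (u == -1)).
  exists d; split=> //; rewrite !big_ord_recr /= /al /ga ?ltnn ?eqxx.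
    rewrite ltnNge leqnSn /= !mul0r !addr0 -dE.
    by apply: eq_bigr => t _; rewrite ltn_ord.
  rewrite gtn_eqF // big1 => [|t _]; last first.
    by rewrite (ltn_eqF (ltn_ord t)) (ltn_eqF (leqW (ltn_ord t))) mul0r.
  by rewrite add0r mul1r mulN1r dT dT1 [RHS]Hu.
- rewrite (eq_bigr (fun j : 'I_N => ((G %| j.+1) + `|xs j|)%N)); last first.
    by move=> j _; rewrite size_cat !size_nseq.
  (* At most [N / G <= M] grid increments and at most [M] units. *)
  rewrite big_split /= count_dvdn // -!(mulnA 2) mul2n -addnn leq_add //.
    by rewrite (leq_trans _ HM) // -(mulKn M G_gt0) leq_div2r.
  exact: leq_trans HM.
- exists g; split=> // i; rewrite gE /vs_sum /vs big_cat /= !sum_nseq mul0r add0r.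
  by rewrite -intEsg.
Qed.

(* The increments at [j] are [`|xs j| %/ G] times [G] and the remainder, up to
   sign; negative ones are encoded in base [B] by their complement to [B ^ T]. *)
Lemma dense_network :
  (N <= w ^ 2 * S ^ 2 * T.+2)%N -> (M <= G * N)%N ->
  exists g : 'cV[R]_1 -> 'cV[R]_1, NN W (4 * S * T.+2) g /\
    forall i : 'I_N, g (const_mx (i.+1)%:R) ord0 ord0 = (xs i)%:~R.
Proof.
move=> HN HM.
pose vs j := sgz (xs j) * (`|xs j| %% G)%N%:Z :: nseq (`|xs j| %/ G) (sgz (xs j) * G%:Z).
(* Digit [T.+1] is the gap, at most [1] as every position carries an increment. Digit [T] is the
   sign, worth [- B ^ T]. *)
pose al t : int := if t == T.+1 then 1 else 0.
pose ga t : int :=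
  if (t < T)%N then (B ^ t)%N%:Z else if t == T then - (B ^ T)%N%:Z else 0.
have [||||g [Hg gE]] := @block_network R N vs S T.+2 w W 1 al ga S_gt0 _ w_gt0 W_ge.
- by [].
- by move=> j; exists 0%N.
- move=> g u j gG Hu.
  have {Hu} uG : (`|u| <= G)%N.
    have sgz1 (z n : int) : (`|n| <= G)%N -> (`|(sgz z * n)%R| <= G)%N.
      by case: (sgzP z); rewrite ?mul0r ?mul1r ?mulN1r ?abszN.
    move: Hu; rewrite inE mem_nseq => /orP[/eqP ->|/andP[_ /eqP ->]]; apply: sgz1.
      by rewrite ltnW ?ltn_pmod.
    by [].
  have lt1 (c : bool) : (c < B)%N by rewrite /B; case: c; lia.
  have gB : (g < B)%N by rewrite (leq_ltn_trans gG (lt1 true)).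
  pose v := if u < 0 then (B ^ T - `|u|)%N else `|u|%N.
  have vB : (v < B ^ T)%N by rewrite /v; case: ifP; lia.
  have [d [d_lt dE dT dT1]] := radix_digits vB (lt1 (u < 0)) gB.
  exists d; split=> //; rewrite !big_ord_recr /= /al /ga ?ltnn ?eqxx.
    rewrite big1 => [|t _]; last by rewrite (ltn_eqF (leqW (ltn_ord t))) mul0r.
    by rewrite ltn_eqF // mul0r !add0r mul1r dT1.
  rewrite ltnNge leqnSn /= gtn_eqF // mul0r addr0 dT.
  rewrite (eq_bigr (fun t : 'I_T => (B ^ t)%N%:Z * (d t)%:Z)); last first.
    by move=> t _; rewrite ltn_ord.
  by rewrite dE /v; case: ifP; lia.
- rewrite (eq_bigr (fun j : 'I_N => (1 + `|xs j| %/ G)%N)); last first.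
    by move=> j _; rewrite /= size_nseq.
  (* One remainder per position, and at most [M / G <= N] multiples of [G]. *)
  rewrite big_split /= sum_nat_const card_ord muln1.
  rewrite -!(mulnA 2) mul2n -addnn leq_add //.
  rewrite (leq_trans _ HN) // -(leq_pmul2l G_gt0) big_distrr /=.
  rewrite (leq_trans _ HM) // (leq_trans _ xsM) //; apply: leq_sum => j _.
  by rewrite mulnC leq_trunc_div.
- exists g; split=> // i; rewrite gE /vs_sum /vs big_cons sum_nseq.
  rewrite -mulrA -mulrDr -PoszM -PoszD addnC (mulnC G) -divn_eq.
  by rewrite -intEsg.
Qed.

End Cases.

(** * Ceilings, roots and the choice of parameters *)

Lemma le_absz_ceil (R : realType) (z : R) : z <= (`|Num.ceil z|%N)%:R.
Proof. by rewrite natr_absz (le_trans (ceil_ge z)) // ler_int ler_norm. Qed.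

Lemma absz_ceil_gt0 (R : realType) (z : R) : 0 < z -> (0 < `|Num.ceil z|)%N.
Proof. by move=> z0; rewrite -(ltr_nat R) (lt_le_trans z0) ?le_absz_ceil. Qed.

Lemma le_root_le_exp (R : realType) (a b T w : nat) : (0 < b)%N -> (0 < T)%N ->
  powR (a%:R / b%:R : R) (T%:R^-1) <= w%:R -> (a <= w ^ T * b)%N.
Proof.
move=> b0 T0 H; have bR : 0 < b%:R :> R by rewrite ltr0n.
have z0 : 0 <= a%:R / b%:R :> R by rewrite divr_ge0 ?ler0n.
rewrite -(ler_nat R) natrM natrX -ler_pdivrMr //.
have -> : a%:R / b%:R = powR (a%:R / b%:R) T%:R^-1 ^+ T :> R.
  by rewrite -powR_mulrn ?powR_ge0 // -powRrM mulVf ?powRr1 // pnatr_eq0 -lt0n.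
by apply: lerXn2r => //; rewrite nnegrE ?powR_ge0 ?ler0n.
Qed.

Theorem mainTheorem7 (R : realType) (N M : nat) (x : 'I_N -> int) :
  (0 < N)%N -> (0 < M)%N ->
  \sum_(i < N) `|x i| <= M%:Z ->
  ((M <= N)%N ->
    forall S T : nat, (0 < S)%N -> (0 < T)%N ->
    exists g : 'cV[R]_1 -> 'cV[R]_1,
      NN (22 * maxn
            `|Num.ceil (Num.sqrt (M%:R : R) / (S%:R * Num.sqrt (T.+2)%:R))|%N
            `|Num.ceil (powR (N%:R / M%:R : R) (T%:R^-1))|%N + 10)
         (4 * S * T.+2) g /\
      forall i : 'I_N, g (const_mx (i.+1)%:R) ord0 ord0 = (x i)%:~R)
  /\
  ((N <= M)%N ->
    forall S T : nat, (0 < S)%N -> (0 < T)%N ->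
    exists g : 'cV[R]_1 -> 'cV[R]_1,
      NN (22 * maxn
            `|Num.ceil ((M%:R : R) / (S%:R * Num.sqrt (N%:R * (T.+2)%:R)))|%N
            `|Num.ceil (powR (M%:R / N%:R : R) (T%:R^-1))|%N + 12)
         (4 * `|Num.ceil ((S * N)%:R / M%:R : R)|%N * T.+2) g /\
      forall i : 'I_N, g (const_mx (i.+1)%:R) ord0 ord0 = (x i)%:~R).
Proof.
move=> N0 M0 xM.
pose xs j := if insub j is Some i then x i else 0.
have xsE (i : 'I_N) : xs i = x i by rewrite /xs valK.
have xsM : (\sum_(j < N) `|xs j| <= M)%N.
  rewrite -lez_nat (big_morph Posz PoszD erefl); apply: le_trans xM.
  by rewrite le_eqVlt (eq_bigr (fun j => `|x j|)) ?eqxx // => j _; rewrite xsE abszE.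
have N0R : 0 < N%:R :> R by rewrite ltr0n.
have M0R : 0 < M%:R :> R by rewrite ltr0n.
split=> _ S T S0 T0; have S0R : 0 < S%:R :> R by rewrite ltr0n.
- set z1 := Num.sqrt _ / _; set z2 := powR _ _; set w := maxn _ _.
  have w1 : z1 <= w%:R by rewrite (le_trans (le_absz_ceil z1)) // ler_nat; exact: leq_maxl.
  have w2 : z2 <= w%:R by rewrite (le_trans (le_absz_ceil z2)) // ler_nat; exact: leq_maxr.
  have T0R : 0 < Num.sqrt (T.+2)%:R :> R by rewrite sqrtr_gt0 ltr0n.
  have w0 : (0 < w)%N.
    by rewrite /w leq_max absz_ceil_gt0 // divr_gt0 ?mulr_gt0 // sqrtr_gt0.
  have [||g [Hg gE]] := @sparse_network R N M xs S T w (22 * w + 10) S0 T0 w0 (leqnn _) xsM.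
  + move: w1; rewrite ler_pdivrMr ?mulr_gt0 // => w1.
    rewrite -(ler_nat R) (natrM _ (w ^ 2 * S ^ 2)) (natrM _ (w ^ 2)) !natrX.
    rewrite -(sqr_sqrtr (ltW M0R)).
    rewrite -(sqr_sqrtr (ler0n R T.+2)) -!exprMn -mulrA.
    by apply: lerXn2r => //; rewrite nnegrE ?mulr_ge0 ?sqrtr_ge0.
  + exact: le_root_le_exp M0 T0 w2.
  + by exists g; split=> // i; rewrite gE xsE.
- set z1 := M%:R / (_ * _); set z2 := powR _ _; set w := maxn _ _; set z3 := (S * N)%:R / _.
  have w1 : z1 <= w%:R by rewrite (le_trans (le_absz_ceil z1)) // ler_nat; exact: leq_maxl.
  have w2 : z2 <= w%:R by rewrite (le_trans (le_absz_ceil z2)) // ler_nat; exact: leq_maxr.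
  have NT0 : 0 < N%:R * (T.+2)%:R :> R by rewrite mulr_gt0 // ltr0n.
  have w0 : (0 < w)%N.
    by rewrite /w leq_max absz_ceil_gt0 // divr_gt0 ?mulr_gt0 // sqrtr_gt0.
  have S'0 : (0 < `|Num.ceil z3|)%N.
    by rewrite absz_ceil_gt0 // divr_gt0 // ltr0n muln_gt0 S0.
  have S'ge := le_absz_ceil z3; set S' := absz _ in S'0 S'ge *.
  have [|||g [Hg gE]] := @dense_network R N M xs S' T w (22 * w + 12) S'0 T0 w0 _ xsM.
  + by rewrite leq_add2l.
  + have SN : (S * N <= S' * M)%N.
      by rewrite -(ler_nat R) (natrM _ S') -ler_pdivrMr.
    have MM : (M ^ 2 <= w ^ 2 * S ^ 2 * (N * T.+2))%N.
      move: w1; rewrite ler_pdivrMr ?mulr_gt0 ?sqrtr_gt0 // => w1.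
      rewrite -(ler_nat R) (natrM _ (w ^ 2 * S ^ 2)) (natrM _ (w ^ 2)) (natrM _ N) !natrX.
      rewrite -(sqr_sqrtr (ltW NT0)) -!exprMn -mulrA.
      by apply: lerXn2r => //; rewrite nnegrE ?mulr_ge0 ?sqrtr_ge0.
    (* [N * M ^ 2 <= w ^ 2 * (T + 2) * (S * N) ^ 2] by [MM], and [S * N <= S' * M]; then [M ^ 2]
       cancels. *)
    rewrite -(@leq_pmul2r (M ^ 2)) ?expn_gt0 ?M0 //.
    apply: (@leq_trans (w ^ 2 * T.+2 * (S * N) ^ 2)).
      have -> : (w ^ 2 * T.+2 * (S * N) ^ 2 = N * (w ^ 2 * S ^ 2 * (N * T.+2)))%N.
        by ring.
      by rewrite leq_mul2l MM orbT.
    have -> : (w ^ 2 * S' ^ 2 * T.+2 * M ^ 2 = w ^ 2 * T.+2 * (S' * M) ^ 2)%N by ring.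
    by rewrite leq_mul2l leq_sqr SN orbT.
  + exact: le_root_le_exp N0 T0 w2.
  + by exists g; split=> // i; rewrite gE xsE.
Qed.
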